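(* Let $X$ be a compact metric space and let $\mathcal{G}$ be a null decomposition of $X$ such that each non-singleton element of $\mathcal{G}$ is a squeezable subset of $X$. Then $\mathcal{G}$ is strongly shrinkable.
   Context: A decomposition of a topological space $X$ means an upper semi-continuous decomposition: a partition $\mathcal{G}$ of $X$ into compact subsets such that the quotient map $\pi : X \to X/\mathcal{G}$ (with $X/\mathcal{G}$ given the quotient topology) is a closed map. If $X$ is compact metrizable, then so is $X/\mathcal{G}$. A collection $\mathcal{C}$ of subsets of a metric space $(X,\rho)$ is null if for every $\epsilon > 0$ the set $\{C \in \mathcal{C} : \mathrm{diam}_\rho(C) \geq \epsilon\}$ is finite. A null decomposition is a decomposition that is a null collection. For $C \subset X$, $\mathcal{H}_C(X)$ denotes the set of all homeomorphisms $h : X \to X$ with $h|_C = \mathrm{id}_C$. A subset $A$ of a compact metric space $(X,\rho)$ is squeezable if $A$ is compact and for every null decomposition $\mathcal{G}$ of $X$ with $A \in \mathcal{G}$, every open neighborhood $U$ of $A$ in $X$, and every $\delta > 0$, there is a homeomorphism $h \in \mathcal{H}_{X-U}(X)$ such that $\mathrm{diam}_\rho(h(A)) < \delta$ and for every $G \in \mathcal{G}$, either $\mathrm{diam}_\rho(h(G)) < \delta$ or $h|_G = \mathrm{id}_G$. A map $\pi : X \to Y$ injects over $C \subset Y$ if $\pi|_{\pi^{-1}(C)} : \pi^{-1}(C) \to C$ is injective. Let $\pi : X \to Y$ be an onto map (continuous surjection) between compact metric spaces with metrics $\rho$ and $\sigma$ respectively, and let $\bar{\sigma}$ be the supremum metric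 on the set $C(X,Y)$ of continuous maps $X \to Y$ determined by $\sigma$. The map $\pi$ satisfies the strong shrinking criterion if for every $\delta > 0$ and every closed subset $C$ of $Y$ such that $\pi$ injects over $C$, there is a homeomorphism $h : X \to X$ such that $\mathrm{diam}_\rho(h(\pi^{-1}(y))) < \delta$ for every $y \in Y$, $\bar{\sigma}(\pi, \pi \circ h^{-1}) < \delta$, and $h|_{\pi^{-1}(C)} = \mathrm{id}_{\pi^{-1}(C)}$. A decomposition $\mathcal{G}$ of a compact metric space $X$ is strongly shrinkable if the quotient map $\pi : X \to X/\mathcal{G}$ satisfies the strong shrinking criterion (with $X/\mathcal{G}$ equipped with any metric inducing its topology). *)

(* Defs.v *)
From HB Require Import structures.
From mathcomp Require Import all_boot all_order all_algebra.
From mathcomp Require Import all_classical all_reals all_analysis.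

Set Implicit Arguments.
Unset Strict Implicit.
Unset Printing Implicit Defensive.

Import Order.TTheory GRing.Theory Num.Theory.

Local Open Scope classical_set_scope.
Local Open Scope ring_scope.
Local Open Scope quotient_scope.

Section decomposition_space.
Context {X : topologicalType}.
Implicit Types (G : set (set X)) (x y : X).

(* When G is a partition, this is the unique element of G containing x. *)
Definition cell G x : set X := \bigcup_(A in [set A | G A /\ A x]) A.

Definition same_cell G : rel X := fun x y => `[< cell G x = cell G y >].

Lemma same_cell_refl G : reflexive (same_cell G).
Proof. by move=> x; apply/asboolP. Qed.

Lemma same_cell_sym G : symmetric (same_cell G).
Proof. by move=> x y; apply/asboolP/asboolP => ->. Qed.

Lemma same_cell_trans G : transitive (same_cell G).
Proof. by move=> y x z /asboolP xy /asboolP yz; apply/asboolP; rewrite xy. Qed.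

Canonical same_cell_equiv G : equiv_rel X :=
  EquivRel (same_cell G) (@same_cell_refl G) (@same_cell_sym G)
    (@same_cell_trans G).

(* X/G. No condition on G is needed to form it: same_cell G is always an
   equivalence relation, whose classes are the elements of G when G is a
   partition (see decomp_mapE). *)
Definition decomp_space G : Type := quotient_topology {eq_quot (same_cell G)}.

HB.instance Definition _ G := Topological.on (decomp_space G).

Definition decomp_map G : X -> decomp_space G :=
  \pi_(quotient_topology {eq_quot (same_cell G)}).

(* Upper semi-continuous decompositions. *)
Definition decomposition G : Prop :=
  [/\ partition G id [set: X],
      forall A, G A -> compact A
    & forall C : set X, closed C -> closed (decomp_map G @` C)].

Lemma cellE G (A : set X) x :
  partition G id [set: X] -> G A -> A x -> cell G x = A.
Proof.
move=> [_ triv _] GA Ax; apply/seteqP; split=> [y [B [GB Bx] By]|y Ay].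
  by rewrite -(triv B A GB GA) //; exists x.
by exists A.
Qed.

Lemma decomp_mapP G x y :
  decomp_map G x = decomp_map G y <-> cell G x = cell G y.
Proof.
have P := @eqmodP _ (same_cell_equiv G) x y.
by split=> [/P/asboolP|/asboolP/P].
Qed.

Lemma decomp_mapE G (A : set X) x y :
  partition G id [set: X] -> G A -> A x ->
  decomp_map G x = decomp_map G y <-> A y.
Proof.
move=> pG GA Ax; rewrite decomp_mapP (cellE pG GA Ax).
split=> [->|Ay]; last by rewrite (cellE pG GA Ay).
have [B GB By] : cover G id y by case: pG => -> _ _.
by rewrite (cellE pG GB By).
Qed.

End decomposition_space.

Section homeomorphisms.
Context {X : topologicalType}.

Definition inverse_homeos (h k : X -> X) : Prop :=
  [/\ continuous h, continuous k, cancel h k & cancel k h].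

Definition homeomorphism (h : X -> X) : Prop := exists k, inverse_homeos h k.

Definition fixes (C : set X) (h : X -> X) : Prop := forall x, C x -> h x = x.

Definition homeos_fixing (C : set X) : set (X -> X) :=
  [set h | homeomorphism h /\ fixes C h].

End homeomorphisms.

Section diameters.
Context {R : realType}.

(* diam set0 = -oo rather than 0; it is only ever compared with positive
   reals, so this makes no difference. *)
Definition diam {X : metricType R} (A : set X) : \bar R :=
  ereal_sup [set (mdist p.1 p.2)%:E | p in A `*` A].

Definition sup_dist {X : Type} {Y : metricType R} (f g : X -> Y) : \bar R :=
  ereal_sup (range (fun x => (mdist (f x) (g x))%:E)).

Definition null_collection {X : metricType R} (G : set (set X)) : Prop :=
  forall e : R, 0 < e -> finite_set [set A | G A /\ (e%:E <= diam A)%E].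

Definition null_decomposition {X : metricType R} (G : set (set X)) : Prop :=
  decomposition G /\ null_collection G.

Definition squeezable {X : metricType R} (A : set X) : Prop :=
  compact A /\
  forall G : set (set X), null_decomposition G -> G A ->
  forall U : set X, open U -> A `<=` U ->
  forall delta : R, 0 < delta ->
  exists h : X -> X,
    [/\ homeos_fixing (~` U) h,
        (diam (h @` A) < delta%:E)%E
      & forall B, G B -> (diam (h @` B) < delta%:E)%E \/ fixes B h].

Definition injects_over {X Y : Type} (f : X -> Y) (C : set Y) : Prop :=
  set_inj (f @^-1` C) f.

Definition strong_shrinking_criterion {X Y : metricType R} (f : X -> Y)
    : Prop :=
  forall (delta : R) (C : set Y), 0 < delta -> closed C -> injects_over f C ->
  exists h k : X -> X,
    [/\ inverse_homeos h k,
        forall y : Y, (diam (h @` (f @^-1` [set y])) < delta%:E)%E,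
        (sup_dist f (f \o k) < delta%:E)%E
      & fixes (f @^-1` C) h].

Record is_metric {T : Type} (d : T -> T -> R) : Prop := IsMetric {
  is_metric_xx : forall x, d x x = 0 ;
  is_metric_eq : forall x y, d x y = 0 -> x = y ;
  is_metric_sym : forall x y, d x y = d y x ;
  is_metric_triangle : forall y x z, d x z <= d x y + d y z }.

(* The metric space with the points of T and the metric d; any topology
   already present on T is forgotten. *)
Definition metrized {T : choiceType} {d : T -> T -> R} (dP : is_metric d)
  : Type := T.

HB.instance Definition _ (T : choiceType) (d : T -> T -> R)
  (dP : is_metric d) := Choice.on (metrized dP).

HB.instance Definition _ (T : choiceType) (d : T -> T -> R)
  (dP : is_metric d) :=
  isMetric.Build R (metrized dP) (is_metric_xx dP) (is_metric_eq dP)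
    (is_metric_sym dP) (is_metric_triangle dP).

Definition induces_topology {T : topologicalType} {d : T -> T -> R}
    (dP : is_metric d) : Prop :=
  forall U : set T, open U <-> open (U : set (metrized dP)).

Definition strongly_shrinkable {X : metricType R} (G : set (set X)) : Prop :=
  forall (sigma : decomp_space G -> decomp_space G -> R)
         (sigmaP : is_metric sigma), induces_topology sigmaP ->
  strong_shrinking_criterion (decomp_map G : X -> metrized sigmaP).

End diameters.

(* Main.v *)
Require Import Defs.
From HB Require Import structures.
From mathcomp Require Import all_boot all_order all_algebra.
From mathcomp Require Import all_classical all_reals all_analysis.

Local Open Scope classical_set_scope.
Local Open Scope ring_scope.

Set Implicit Arguments.
Unset Strict Implicit.

Import Order.TTheory GRing.Theory Num.Theory.

(** Let f : X -> X/G be the quotient map and d > 0. Nullity leaves only finitely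
    many fibers of f of diameter at least d. Each of them has more than one
    point, hence is squeezable and does not lie over C, since f injects over C.
    So the corresponding points y of X/G have pairwise disjoint balls V y that
    miss C and have radius at most d / 4, and the open sets f^-1(V y) are
    pairwise disjoint and saturated.

    Squeeze each large fiber inside its own f^-1(V y), and compose the resulting
    homeomorphisms (shrink_finitely_many). A fiber meets the support of at most
    one of them, and each of them makes every fiber small or fixes it pointwise;
    hence each fiber either has a small image under the composite, or was already
    small and has not moved. A point that moves stays in a single f^-1(V y), so
    its image in X/G moves by at most d / 2. Nothing moves over C.

    The squeezing homeomorphism of one large fiber is asked to control all the
    fibers of the original decomposition, and disjointness of the supports keeps
    that control through the composition. This is why the squeezings need not be
    performed successively on transformed decompositions. *)

Lemma diam1 (R : realType) (X : metricType R) (x : X) :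
  diam [set x] = 0%E :> \bar R.
Proof.
rewrite /diam (_ : [set _ | _ in _] = [set 0%E]) ?ereal_sup1//.
apply/seteqP; split=> [_ [[a b] /= [-> ->] <-]|_ ->]; first by rewrite mdistxx.
by exists (x, x) => //=; rewrite mdistxx.
Qed.

Lemma inverse_homeos_comp (X : topologicalType) (h k h' k' : X -> X) :
  inverse_homeos h k -> inverse_homeos h' k' ->
  inverse_homeos (h \o h') (k' \o k).
Proof.
move=> [ch ck hk kh] [ch' ck' hk' kh']; split.
- by move=> x; apply: continuous_comp; [exact: ch'|exact: ch].
- by move=> x; apply: continuous_comp; [exact: ck|exact: ck'].
- exact: can_comp.
- exact: can_comp.
Qed.

Lemma fixes_compl_stable (T : topologicalType) (U : set T) (h : T -> T) x :
  injective h -> fixes (~` U) h -> U x -> U (h x).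
Proof.
move=> hI hU Ux; have [//|nUhx] := pselect (U (h x)).
by move: (nUhx); rewrite (hI _ _ (hU _ nUhx)).
Qed.

Lemma eq_diam_image (R : realType) (X : metricType R) (A : set X)
    (g h : X -> X) (d : \bar R) :
  (forall x, A x -> g x = h x) -> (diam (h @` A) < d)%E -> (diam (g @` A) < d)%E.
Proof. by move=> gh; rewrite (eq_imagel gh). Qed.

(** The last clause holds because the V y are disjoint: on the fiber over z the
    composite agrees with the homeomorphism attached to the only V y that can
    contain z, or with the identity if there is none. When z = y this
    homeomorphism shrinks the fiber. The third clause, invariance of each f^-1(V y), is what lets
    the homeomorphisms be composed without interfering, and it also bounds the
    displacement of f. *)
Lemma shrink_finitely_many (R : realType) (X : metricType R) (Y : eqType)
    (f : X -> Y) (V : Y -> set Y) (d : \bar R) (s : seq Y) :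
  trivIset [set` s] V -> (forall y, y \in s -> V y y) ->
  (forall y, y \in s -> exists h : X -> X,
    [/\ homeos_fixing (~` (f @^-1` V y)) h,
        (diam (h @` (f @^-1` [set y])) < d)%E
      & forall z, (diam (h @` (f @^-1` [set z])) < d)%E \/
                  fixes (f @^-1` [set z]) h]) ->
  exists h k : X -> X,
    [/\ inverse_homeos h k,
        forall x, (forall y, y \in s -> ~ V y (f x)) -> h x = x,
        forall x y, y \in s -> V y (f x) -> V y (f (h x))
      & forall z, (diam (h @` (f @^-1` [set z])) < d)%E \/
                  z \notin s /\ fixes (f @^-1` [set z]) h].
Proof.
elim: s => [|y s IH] disj Vc sq.
  by exists id, id; split=> [|//|//|z]; [split=> // x; exact: cvg_id|right].
have ss : {subset s <= y :: s} by move=> u us; rewrite inE us orbT.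
have [|||h [k [hk hout hin hsmall]]] := IH.
- by apply: sub_trivIset disj => u /ss.
- by move=> u /ss; exact: Vc.
- by move=> u /ss; exact: sq.
(* If y is repeated in s, its fiber has already been squeezed. *)
have [ys|ys] := boolP (y \in s).
  have memE u : (u \in y :: s) = (u \in s) by rewrite inE; case: eqP => [->|].
  exists h, k; split=> [//|x xV|x u|z].
  - by apply: hout => u us; apply: xV; rewrite memE.
  - by rewrite memE; exact: hin.
  - by rewrite memE.
have y_s : y \in y :: s by rewrite mem_head.
have [g [[[l gl] gout] gy gsmall]] := sq y y_s.
have [_ _ gK _] := gl; have gI := can_inj gK.
have sep u x : u \in s -> V u (f x) -> ~ V y (f x).
  move=> us Vux Vyx; move: ys; rewrite -(disj u y (ss _ us) y_s) ?us//.
  by exists (f x).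
(* The composite agrees with g over V y and with h elsewhere. *)
have ghV x : V y (f x) -> g (h x) = g x.
  by move=> Vyx; rewrite hout// => u us Vux; exact: (sep u x).
have ghNV x : ~ V y (f x) -> g (h x) = h x.
  move=> Vyx; apply: gout => /=.
  have [[u us Vux]|noV] := pselect (exists2 u, u \in s & V u (f x)).
    by apply: (sep u) => //; exact: hin.
  by rewrite hout// => u us Vux; apply: noV; exists u.
exists (g \o h), (k \o l); split.
- exact: inverse_homeos_comp.
- move=> x xV /=; have Vyx := xV y y_s.
  by rewrite ghNV// hout// => u /ss; exact: xV.
- move=> x u; rewrite inE => /predU1P[-> Vyx|us Vux] /=.
    by rewrite ghV//; exact: (fixes_compl_stable (U := f @^-1` V y) gI gout).
  by rewrite ghNV; [exact: hin|exact: sep us Vux].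
- move=> z; have [Vyz|Vyz] := pselect (V y z).
    have E x : (f @^-1` [set z]) x -> (g \o h) x = g x.
      by move=> /= fx; apply: ghV; rewrite fx.
    have [->|zy] := eqVneq z y.
      left; apply: eq_diam_image gy => x /= fx; apply: ghV.
      by rewrite fx; exact: Vc.
    case: (gsmall z) => [gz|gz]; first by left; exact: eq_diam_image E gz.
    right; split; last by move=> x fx; rewrite E// gz.
    rewrite inE (negbTE zy)/=; apply/negP => zs.
    move/negP: zy; apply; apply/eqP/disj => //; first exact: ss.
    by exists z; split=> //; exact/Vc/ss.
  have E x : (f @^-1` [set z]) x -> (g \o h) x = h x.
    by move=> /= fx; apply: ghNV; rewrite fx.
  case: (hsmall z) => [hz|[zs hz]]; first by left; exact: eq_diam_image E hz.
  right; split; last by move=> x fx; rewrite E// hz.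
  rewrite inE negb_or zs andbT; apply/eqP => zy.
  by apply: Vyz; rewrite zy; exact: Vc.
Qed.

Lemma near_finite (I : choiceType) (T : Type) (F : set_system T)
    (D : set I) (P : I -> T -> Prop) : Filter F -> finite_set D ->
  (forall i, D i -> \forall t \near F, P i t) ->
  \forall t \near F, forall i, D i -> P i t.
Proof. by move=> FF /finite_fsetP[S ->] /(filter_bigI FF). Qed.

Lemma near_trivIset_ball (R : realType) (Y : metricType R) (D : set Y) :
  finite_set D -> \forall e \near (0 : R)^'+, trivIset D (fun y : Y => ball y e).
Proof.
move=> finD; suff: \forall e \near (0 : R)^'+, forall y, D y ->
    forall z, D z -> ball y e `&` ball z e !=set0 -> y = z.
  by apply: filterS => e H y z Dy; exact: H.
apply: near_finite => // y Dy; apply: near_finite => // z Dz.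
have [->|yz] := eqVneq y z; first by apply: nearW.
have yz0 : 0 < mdist y z / 2 by rewrite divr_gt0// mdist_gt0.
near=> e => -[x [yx /ball_sym zx]].
have : mdist y z < e + e.
  by have := ball_triangle yx zx; rewrite ballEmdist.
rewrite ltNge (splitr (mdist y z)) lerD//; near: e; exact: nbhs_right_ltW.
Unshelve. all: by end_near. Qed.

Lemma near_ball_sub (R : realType) (Y : metricType R) (y : Y) (U : set Y) :
  open U -> U y -> \forall e \near (0 : R)^'+, ball y e `<=` U.
Proof.
move=> oU Uy; have /nbhs_ballP[r /= r0 rU] : nbhs y U by exact: open_nbhs_nbhs.
near=> e; apply: subset_trans rU; apply: le_ball.
by near: e; exact: nbhs_right_ltW.
Unshelve. all: by end_near. Qed.

(** A metric inducing the quotient topology enters the argument only through the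
    continuity of f, so f can be any continuous surjection onto a metric space
    whose fibers belong to G. *)
Lemma null_squeezable_strong_shrinking (R : realType) (X Y : metricType R)
    (f : X -> Y) (G : set (set X)) :
  continuous f -> (forall y, G (f @^-1` [set y])) ->
  (forall y, f @^-1` [set y] !=set0) ->
  null_decomposition G ->
  (forall A, G A -> ~ (exists x : X, A = [set x]) -> squeezable A) ->
  strong_shrinking_criterion f.
Proof.
move=> cf Gf f_surj nG sG d C d0 clC injC.
pose D := [set y : Y | (d%:E <= diam (f @^-1` [set y]))%E].
(* Distinct points have distinct fibers, as fibers are nonempty; so nullity of G
   bounds the number of points as well as the number of fibers. *)
have finD : finite_set D.
  have -> : D = (fun y => f @^-1` [set y]) @^-1`
      [set A | G A /\ (d%:E <= diam A)%E].
    by apply/seteqP; split=> y /=; [split|case].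
  apply: finite_preimage; last exact: nG.2.
  move=> y z _ _ E; have [x fx] := f_surj y.
  by move: (fx); rewrite E /= => <-.
have D_large y : D y -> ~ (exists x, f @^-1` [set y] = [set x]).
  by move=> + [x E]; rewrite /D /= E diam1 lee_fin leNgt d0.
have CD y : D y -> (~` C) y.
  move=> Dy Cy; have [x fx] := f_surj y; apply: (D_large y Dy).
  exists x; apply/seteqP; split=> [z /= fz|_ -> //].
  by apply: injC; rewrite ?inE /= ?fx ?fz.
(* Two points of a ball of radius d / 4 are at distance at most d / 2, which
   leaves room for the supremum of the displacements to stay below d. *)
have d20 : 0 < d / 2 / 2 by rewrite !divr_gt0.
have [e [e0 ed disj eC]] : exists e : R, [/\ 0 < e, e <= d / 2 / 2,
    trivIset D (fun y : Y => ball y e)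
  & forall y, D y -> ball y e `<=` ~` C].
  apply: (@filter_ex _ (0 : R)^'+); near=> e; split=> //; near: e.
  - exact: nbhs_right_ltW.
  - exact: near_trivIset_ball.
  - apply: near_finite => // y Dy.
    by apply: near_ball_sub; [rewrite openC|exact: CD].
have [s Ds] := (finite_seqP _).1 finD.
pose V y : set Y := (ball y e)°.
have Ve y : V y `<=` ball y e by exact: interior_subset.
have Vyy y : V y y by have [] := open_nbhs_ball y (PosNum e0).
have [|//||h [k [hk hout hin hsmall]]] :=
    @shrink_finitely_many _ X Y f V d%:E s.
- rewrite -Ds => y z Dy Dz [x [/Ve yx /Ve zx]].
  by apply: disj => //; exists x.
- move=> y ys; have Dy : D y by rewrite Ds.
  have [_ sq] := sG _ (Gf y) (D_large y Dy).
  have [||h [hfix hy hG]] := sq G nG (Gf y) (f @^-1` V y) _ _ d d0.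
  + by apply: open_comp => [x _|]; [exact: cf|exact: open_interior].
  + by move=> x /= ->.
  + by exists h; split=> // z; exact: hG.
exists h, k; split=> //.
- move=> z; case: (hsmall z) => // -[zs hz].
  rewrite (eq_imagel (f' := id))// image_id ltNge; apply/negP => Dz.
  by move/negP: zs; apply; have : [set` s] z by rewrite -Ds.
- apply: (@le_lt_trans _ _ (d / 2)%:E); last first.
    by rewrite lte_fin gtr_pMr// invf_lt1// ltr1n.
  apply: ge_ereal_sup => _ [x _ <-]; rewrite lee_fin /=.
  have [_ _ _ kK] := hk.
  have [[y ys Vy]|noV] := pselect (exists2 y, y \in s & V y (f (k x))).
    have := ball_triangle (ball_sym (Ve _ _ (hin _ _ ys Vy))) (Ve _ _ Vy).
    rewrite kK ballEmdist => /ltW/le_trans; apply.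
    by rewrite (splitr (d / 2)) lerD.
  rewrite -{1}(kK x) hout ?mdistxx ?divr_ge0 ?ltW// => y ys Vy.
  by apply: noV; exists y.
- move=> x Cx; apply: hout => y ys /Ve Vy.
  by have Dy : D y by [rewrite Ds]; exact: eC Dy _ Vy Cx.
Unshelve. all: by end_near. Qed.

Lemma decomp_map_fiber (X : topologicalType) (G : set (set X))
    (y : decomp_space G) :
  partition G id [set: X] ->
  G (decomp_map G @^-1` [set y]) /\ decomp_map G @^-1` [set y] !=set0.
Proof.
move=> pG; have [x <-] : exists x, decomp_map G x = y.
  by exists (@repr _ (quotient_topology {eq_quot same_cell G})%qT y);
    exact: reprK.
have [A GA Ax] : cover G id x by case: pG => -> _ _.
split; last by exists x.
rewrite (_ : _ @^-1` _ = A)//; apply/seteqP; split=> z /=.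
- by move/esym/(decomp_mapE z pG GA Ax).
- by move/(decomp_mapE z pG GA Ax).
Qed.

Theorem theorem1 (R : realType) (X : metricType R) (cX : compact [set: X])
    (G : set (set X)) (nG : null_decomposition G)
    (sG : forall A : set X, G A -> ~ (exists x : X, A = [set x]) ->
      squeezable A) :
  strongly_shrinkable G.
Proof.
move=> sigma sigmaP top; have [[pG _ _] _] := nG.
apply: (@null_squeezable_strong_shrinking R X (metrized sigmaP) _ G) => //.
- apply/continuousP => U /top oU.
  (* Openness in the quotient is by definition openness of the preimage. *)
  exact: oU.
- by move=> y; have [] := decomp_map_fiber y pG.
- by move=> y; have [] := decomp_map_fiber y pG.
Qed.
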